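(* Let $G$ be a graph with maximum degree $\Delta(G)$. If $\Delta(G)\leq 3$, then $\chi'_{gl}(G)\leq \Delta(G)+1$; and if $\Delta(G)=4$, then $\chi'_{gl}(G)\leq 6$.
   Context: All graphs are finite and simple; $\Delta(G)$ is the maximum degree of $G$. $\ell(G)$ denotes the line graph of $G$ (its vertices are the edges of $G$, two being adjacent iff they share an endpoint in $G$). Let $H$ be a graph with a fixed orientation of its edges, $A$ an Abelian group, $L:V(H)\to 2^A$ a list assignment and $f:E(H)\to A$. An $(A,L,f)$-coloring of $H$ is a map $c:V(H)\to A$ with $c(v)\in L(v)$ for every vertex $v$ and $c(x)-c(y)\neq f(xy)$ for every edge $xy$ directed from $x$ to $y$. $H$ is $(A,L)$-colorable if it has an $(A,L,f)$-coloring for every $f:E(H)\to A$ (this does not depend on the orientation). $H$ is $k$-group choosable if it is $(A,L)$-colorable for every Abelian group $A$ of order at least $k$ and every $L$ with $|L(v)|=k$ for all $v\in V(H)$. $\chi_{gl}(H)$ is the smallest $k$ such that $H$ is $k$-group choosable. $G$ is edge-$k$-group choosable if $\ell(G)$ is $k$-group choosable, and $\chi'_{gl}(G)=\chi_{gl}(\ell(G))$. *)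

(* Defs.v *)
From HB Require Import structures.
From mathcomp Require Import all_boot all_order all_algebra finmap.
From mathcomp Require Import boolp classical_sets functions cardinality.

Set Implicit Arguments.
Unset Strict Implicit.
Unset Printing Implicit Defensive.

Import GRing.Theory.

Record sgraph := SGraph {
  vertex :> finType;
  adj : rel vertex;
  adj_sym : symmetric adj;
  adj_irrefl : irreflexive adj }.

Definition max_degree (G : sgraph) : nat :=
  \max_(x : G) #|[pred y | adj x y]|.

Definition edges (G : sgraph) : {set {set G}} :=
  [set [set p.1; p.2] | p : G * G & adj p.1 p.2]%SET.

Definition edge (G : sgraph) : finType := {e : {set G} | e \in edges G}.

Section LineGraph.
Variable G : sgraph.

Definition line_adj : rel (edge G) := fun e1 e2 =>
  (e1 != e2) && ~~ [disjoint val e1 & val e2].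

Lemma line_adj_sym : symmetric line_adj.
Proof. by move=> e1 e2; rewrite /line_adj eq_sym disjoint_sym. Qed.

Lemma line_adj_irrefl : irreflexive line_adj.
Proof. by move=> e; rewrite /line_adj eqxx. Qed.

Definition line_graph : sgraph := SGraph line_adj_sym line_adj_irrefl.

End LineGraph.

Record orientation (H : sgraph) := Orientation {
  tail : edge H -> H;
  head : edge H -> H;
  orientationP : forall e, val e = [set tail e; head e]%SET }.

Definition is_group_coloring (H : sgraph) (o : orientation H) (A : zmodType)
    (L : H -> set A) (f : edge H -> A) (c : H -> A) : Prop :=
  (forall v, L v (c v)) /\
  (forall e, (c (tail o e) - c (head o e))%R <> f e).

Definition group_colorable (H : sgraph) (o : orientation H) (A : zmodType)
    (L : H -> set A) : Prop :=
  forall f : edge H -> A, exists c, is_group_coloring o L f c.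

(* The orientation is immaterial: see [group_colorable_orientation] and
   [orientation_exists] below. *)
Definition group_choosable (H : sgraph) (k : nat) : Prop :=
  forall (o : orientation H) (A : zmodType) (L : H -> set A),
    (`I_k #<= [set: A])%card ->
    (forall v, L v #= `I_k)%card ->
    group_colorable o L.

Section Orientation.
Variable H : sgraph.

Lemma edge_pair (e : edge H) :
  exists p : H * H, adj p.1 p.2 /\ val e = [set p.1; p.2]%SET.
Proof.
by case: e => e /= /imsetP[p]; rewrite inE => adjp ->; exists p.
Qed.

Lemma orientation_exists : inhabited (orientation H).
Proof.
have [p hp] := choice edge_pair.
by constructor; exists (fun e => (p e).1) (fun e => (p e).2) => e; case: (hp e).
Qed.

Lemma adj_tail_head (o : orientation H) (e : edge H) :
  adj (tail o e) (head o e).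
Proof.
have [[x y] /= [xy]] := edge_pair e; rewrite (orientationP o) => /setP eq_e.
have nxy : x != y by apply: contraTneq xy => ->; rewrite adj_irrefl.
have xin : (x == tail o e) || (x == head o e).
  by have := eq_e x; rewrite !inE eqxx.
have yin : (y == tail o e) || (y == head o e).
  by have := eq_e y; rewrite !inE eqxx orbT.
move: xin yin nxy xy => /orP[] /eqP -> /orP[] /eqP ->; rewrite ?eqxx //.
by rewrite adj_sym.
Qed.

Lemma orientation_swap (o o' : orientation H) (e : edge H) :
  tail o e <> tail o' e -> tail o e = head o' e /\ head o e = tail o' e.
Proof.
move=> /eqP /negPf ne.
have := orientationP o e; rewrite (orientationP o') => /setP eq_e.
have := eq_e (tail o e); have := eq_e (tail o' e).
rewrite !inE !eqxx ne [_ == tail o e]eq_sym ne /=.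
by move=> /esym/eqP -> /eqP ->.
Qed.

Lemma group_colorable_orientation (o o' : orientation H) (A : zmodType)
    (L : H -> set A) :
  group_colorable o L -> group_colorable o' L.
Proof.
move=> col f.
have [c [cL cf]] :=
  col (fun e => if tail o e == tail o' e then f e else (- f e)%R).
exists c; split=> // e ce; apply: (cf e); case: eqP => [eq_t|ne_t].
  suff -> : head o e = head o' e by rewrite eq_t.
  have := orientationP o e; rewrite (orientationP o') eq_t => /setP eq_e.
  have := eq_e (head o e); rewrite !inE eqxx orbT => /orP[|/eqP //].
  rewrite -eq_t => /eqP he; have := adj_tail_head o e.
  by rewrite he adj_irrefl.
by have [-> ->] := orientation_swap ne_t; rewrite -ce opprB.
Qed.

Lemma edge_inj (o : orientation H) (e e' : edge H) :
  (tail o e = tail o e' /\ head o e = head o e') \/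
  (tail o e = head o e' /\ head o e = tail o e') -> e = e'.
Proof.
move=> h; apply: val_inj; rewrite !(orientationP o).
by case: h => -[-> ->] //; rewrite finset.setUC.
Qed.

Lemma fresh_color (A : zmodType) (X : set A) (n : nat) (s : seq A) :
  (X #= `I_n)%card -> size s < n -> exists2 a, X a & a \notin s.
Proof.
move=> Xn sn; have finX : finite_set X by apply/finite_setP; exists n.
have [//|no] := pselect (exists2 a, X a & a \notin s).
have sub : {subset fset_set X <= s}.
  move=> a; rewrite in_fset_set // inE => Xa.
  by apply/negPn/negP => nas; apply: no; exists a.
have := uniq_leq_size (fset_uniq (fset_set X)) sub.
by rewrite (card_fset_set Xn) leqNgt sn.
Qed.

(* Greedy colouring: the minimum defining [chi_gl] is over a nonempty set. *)
Lemma group_choosable_card : group_choosable H #|H|.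
Proof.
move=> o A L _ cardL f.
suff greedy (s : seq H) : uniq s -> exists c : H -> A, (forall v, L v (c v)) /\
    forall e, tail o e \in s -> head o e \in s ->
      (c (tail o e) - c (head o e))%R <> f e.
  have [c [cL cf]] := greedy (enum H) (enum_uniq H).
  by exists c; split=> // e; apply: cf; rewrite mem_enum.
elim: s => [_|x s IHs /= /andP[xs us]].
  have ex v : exists a, L v a.
    have [||a La _] := @fresh_color A (L v) #|H| [::] => //; last by exists a.
    by apply/card_gt0P; exists v.
  by have [c cL] := choice ex; exists c.
have [c [cL cf]] := IHs us.
pose to y := [pred e | (tail o e == x) && (head o e == y)].
pose from y := [pred e | (tail o e == y) && (head o e == x)].
pose g y : A := if [pick e | to y e] is Some e then (f e + c y)%R else
  if [pick e | from y e] is Some e then (c y - f e)%R else 0%R.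
have [||a La nas] := @fresh_color A (L x) #|H| (map g s) => //.
  rewrite size_map; have /card_uniqP /= : uniq (x :: s) by rewrite /= xs.
  by move=> szs; have := max_card [in x :: s]; rewrite szs.
exists (fun v => if v == x then a else c v); split=> [v|e].
  by case: eqP => // ->.
have nth := adj_tail_head o e.
rewrite !inE; case: eqP => [tx _|_ /= ts]; case: eqP => [hx _|_ /= hs].
- by move: nth; rewrite tx hx adj_irrefl.
- move=> ce; case/mapP: nas; exists (head o e) => //; rewrite /g.
  case: pickP => [e' /= /andP[/eqP te' /eqP he']|/(_ e)]; last first.
    by rewrite /= tx !eqxx.
  have -> : e' = e by apply: (@edge_inj o); left; rewrite tx.
  by rewrite -ce subrK.
- move=> ce; case/mapP: nas; exists (tail o e) => //; rewrite /g.
  case: pickP => [e' /= /andP[/eqP te' /eqP he']|_].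
    have ee : e' = e by apply: (@edge_inj o); right; rewrite hx.
    by move: nth; rewrite -ee te' -[X in adj X _]hx -ee he' adj_irrefl.
  case: pickP => [e' /= /andP[/eqP te' /eqP he']|/(_ e)]; last first.
    by rewrite /= hx !eqxx.
  have -> : e' = e by apply: (@edge_inj o); left; rewrite hx.
  by rewrite -ce subKr.
- exact: cf.
Qed.

End Orientation.

Lemma group_choosable_ex (H : sgraph) : exists k, `[< group_choosable H k >].
Proof. by exists #|H|; apply/asboolP; apply: group_choosable_card. Qed.

Definition chi_gl (H : sgraph) : nat := ex_minn (group_choosable_ex H).

Definition edge_group_choosable (G : sgraph) (k : nat) : Prop :=
  group_choosable (line_graph G) k.

Definition chi_gl' (G : sgraph) : nat := chi_gl (line_graph G).

(* Main.v *)
Require Import Defs.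
From mathcomp Require Import all_order all_algebra finmap boolp cardinality.
From mathcomp Require classical_sets.
From mathcomp Require Import all_boot zify.

(** The line graph of [G] has maximum degree at most [2 * Delta - 2], so the
    theorem is a Brooks-type bound for a line graph, with [k] colors where
    [k >= Delta + 1] and [k >= 2 * Delta - 2]. Group coloring is treated as
    correspondence coloring: all that matters about the equations
    [c x - c y = f e] is that, along an edge, every color of one end forbids at
    most one color of the other.

    Call a set [S] of vertices of the line graph reducible when it can be
    colored from all lists of the sizes that are left after any coloring of its
    complement from lists of [k] colors; such a coloring then always extends
    to [S]. A reducible set
    stays reducible when one adds to it a vertex that has a neighbor in it or
    has fewer than [k] neighbors in all ([reducible_attach]), since that vertex
    can be colored first, or when one adds a disjoint set reducible by itself
    ([reducibleU]). Let [T] be a largest reducible set. If some edge of [G] lies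
    outside [T], then the edges outside [T] are closed under adjacency and all
    have at least [k] neighbors, so by the choice of [k] their ends have degree
    at least 3 in [G]. A longest path among these ends, closed up at the second
    neighbor of its first vertex [v], yields a cycle through [v] and one more
    edge [vb] with [b] off the cycle ([cycle_with_extra_edge]).

    The edges of such a configuration form a reducible set
    ([reducible_cycle]), which contradicts the choice of [T]. Indeed let [e] be
    a cycle edge at [v] and [p = vb]. Inside the configuration [e] has at least
    3 neighbors and [p] only 2. After trimming the list of [p] to 2 colors, [e]
    has a color that forbids none of them. Once [e] has received it, [p] has
    one color to spare, and the rest is colored greedily along the cycle
    towards [p], which comes last ([reducible_core]). *)

Set Implicit Arguments.
Unset Strict Implicit.
Unset Printing Implicit Defensive.

Local Open Scope nat_scope.
Local Open Scope set_scope.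

(** * Lists from which few colors are forbidden *)

(** Each index forbids at most one color, so avoiding all the indices in [r]
    costs at most [size r] colors. *)
Lemma leq_size_avoid (I : Type) (A : eqType) (R : I -> A -> bool)
    (r : seq I) (s : seq A) :
  (forall i a a', R i a -> R i a' -> a = a') -> uniq s ->
  size s <= size [seq a <- s | ~~ has (R ^~ a) r] + size r.
Proof.
move=> Rinj; elim: r s => [|i r IHr] s us /=; first by rewrite filter_predT addn0.
have -> : [seq a <- s | ~~ (R i a || has (R ^~ a) r)] =
          [seq a <- [seq a <- s | ~~ R i a] | ~~ has (R ^~ a) r].
  by rewrite -filter_predI; apply: eq_filter => a /=; rewrite negb_or andbC.
have := IHr _ (filter_uniq (fun a => ~~ R i a) us).
have : count (R i) s <= 1.
  rewrite -size_filter; have := filter_uniq (R i) us.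
  case E: [seq a <- s | R i a] => [|a [|b l]] //=.
  have : (a \in filter (R i) s) && (b \in filter (R i) s).
    by rewrite E !inE !eqxx orbT.
  rewrite !mem_filter => /andP[/andP[Ra _] /andP[Rb _]].
  by rewrite (Rinj _ _ _ Ra Rb) inE eqxx.
have := count_predC (R i) s; rewrite (size_filter (fun a => ~~ R i a)).
rewrite (@eq_count _ (fun a => ~~ R i a) (predC (R i))) //; lia.
Qed.

(** * Degrees inside a set of vertices *)

Section Degree.
Variable H : sgraph.
Implicit Types (S X : {set H}) (x y : H).

Definition deg_in S x := #|[set y in S | adj x y]|.

Lemma deg_inU X S x :
  [disjoint X & S] -> deg_in (X :|: S) x = deg_in X x + deg_in S x.
Proof.
move=> dXS; rewrite /deg_in -cardsUI; set I := _ :&: _.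
have -> : I = set0.
  apply/setP => y; rewrite !inE; apply/negP => /andP[/andP[yX _] /andP[yS _]].
  by rewrite (disjointFr dXS yX) in yS.
rewrite cards0 addn0; apply: eq_card => y.
by rewrite !inE andb_orl.
Qed.

Lemma deg_in_gt0 S x y : y \in S -> adj x y -> 0 < deg_in S x.
Proof. by move=> yS xy; apply/card_gt0P; exists y; rewrite inE yS. Qed.

Lemma deg_in1 x y : adj x y -> deg_in [set y] x = 1.
Proof.
move=> xy; rewrite /deg_in -(cards1 y); apply: eq_card => z.
by rewrite !inE; case: eqP => // ->.
Qed.

End Degree.

(** * Reducible sets for correspondence coloring *)

Section Correspondence.
Variables (H : sgraph) (A : eqType) (a0 : A) (clash : H -> A -> H -> A -> bool).
Hypothesis clash_sym : forall x a y b, clash x a y b = clash y b x a.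
Hypothesis clash_adj : forall x a y b, clash x a y b -> adj x y.
Hypothesis clash_inj :
  forall x y b a a', clash x a y b -> clash x a' y b -> a = a'.
Implicit Types (S X : {set H}) (M : H -> seq A) (t : H -> nat).

Definition coloring M S (c : H -> A) :=
  {in S, forall x, c x \in M x} /\
  {in S &, forall x y, ~~ clash x (c x) y (c y)}.

Definition residual M (c : H -> A) X x :=
  [seq a <- M x | [forall y in X, ~~ clash x a y (c y)]].

(** The slack [t x] counts the colors that [x] has in excess of its degree in
    [S]. For lists of [k] colors and an arbitrary coloring of the complement of
    [S], at least [k] minus the full degree of [x] can be guaranteed; slack 0
    everywhere is the property of being degree-choosable. *)
Definition reducible t S := forall M, (forall x, uniq (M x)) ->
  {in S, forall x, t x + deg_in S x <= size (M x)} ->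
  exists c, coloring M S c.

(** Coloring [X] first leaves to [S] the residual lists. The two sets may
    overlap: the first coloring then wins. *)
Lemma coloringU M X S c d : coloring M X c -> coloring (residual M c X) S d ->
  coloring M (X :|: S) (fun x => if x \in X then c x else d x).
Proof.
move=> [cM cX] [dM dS]; split=> [x|x y]; rewrite !inE.
  by case: ifP => [xX _|_ /= /dM]; [apply: cM | rewrite mem_filter => /andP[]].
have out z w : z \in S -> w \in X -> ~~ clash z (d z) w (c w).
  by move=> /dM; rewrite mem_filter => /andP[/forall_inP] h _ /h.
case: ifP => [xX _|_ /= xS]; case: ifP => [yX _|_ /= yS].
- exact: cX.
- by rewrite clash_sym out.
- exact: out.
- exact: dS.
Qed.

Lemma residual_uniq M c X x : uniq (M x) -> uniq (residual M c X x).
Proof. exact: filter_uniq. Qed.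

Lemma leq_size_residual M c X x : uniq (M x) ->
  size (M x) <= size (residual M c X x) + deg_in X x.
Proof.
move=> uM; pose r := enum [set y in X | adj x y].
have := @leq_size_avoid _ _ (fun y a => clash x a y (c y)) r (M x).
rewrite /r -cardE => /(_ _ uM); rewrite /deg_in => le.
apply: leq_trans (le _) _; first by move=> y a a'; apply: clash_inj.
rewrite leq_add2r !size_filter; apply/eq_leq/eq_count => a /=; rewrite -all_predC.
apply/allP/forall_inP => [no y yX|no y].
  apply/negP => xy; have /= := no y; rewrite xy mem_enum inE yX (clash_adj xy).
  by move/(_ isT).
by rewrite mem_enum inE => /andP[/no].
Qed.

(** Coloring [X] first costs each vertex of [S] at most its degree in [X], which
    is what its degree loses in passing from [X :|: S] to [S]. *)
Lemma reducibleU t X S : [disjoint X & S] ->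
  (forall M, (forall x, uniq (M x)) ->
     {in X, forall x, t x + deg_in (X :|: S) x <= size (M x)} ->
     exists c, coloring M X c) ->
  reducible t S -> reducible t (X :|: S).
Proof.
move=> dXS colX redS M uM szM.
have [|c cX] := colX M uM; first by move=> x xX; apply: szM; rewrite inE xX.
have [||d dS] := redS (residual M c X).
- by move=> x; apply: residual_uniq.
- move=> x xS; have := szM x; rewrite inE xS orbT => /(_ isT).
  have := leq_size_residual c X (uM x); rewrite deg_inU //; lia.
by exists (fun x => if x \in X then c x else d x); apply: coloringU.
Qed.

Lemma coloring1 M x a : a \in M x -> coloring M [set x] (fun=> a).
Proof.
move=> aM; split=> [y /set1P -> //|y z /set1P -> /set1P ->].
by apply/negP => /clash_adj; rewrite adj_irrefl.
Qed.

Lemma reducible0 t : reducible t set0.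
Proof. by move=> M _ _; exists (fun=> a0); split=> x; rewrite inE. Qed.

(** When [x] is colored before [S], a neighbor still to be colored in [S], or
    the slack, guarantees that its list is not empty. *)
Lemma reducible_attach t S x :
  0 < t x \/ (exists2 y, y \in S & adj x y) ->
  reducible t S -> reducible t (x |: S).
Proof.
move=> hx redS; have [xS|xS] := boolP (x \in S); first by rewrite (setUidPr _) ?sub1set.
apply: reducibleU => //; first by rewrite disjoints1.
move=> M uM /(_ x (set11 x)) szM; suff : 0 < size (M x).
  by case EM: (M x) => [|a l] // _; exists (fun=> a); apply: coloring1; rewrite EM mem_head.
apply: leq_trans szM; rewrite addn_gt0; case: hx => [->//|[y yS xy]].
by rewrite (@deg_in_gt0 _ _ _ y) ?orbT // inE yS orbT.
Qed.

(** The step that gains one color over greedy coloring. Since [e] has more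
    colors than a list of [deg_in (e |: S) p] colors at its neighbor [p], some
    color of [e] forbids none of the latter. With that color [e] lowers the
    degree of [p] without using up its list, and [p] acquires slack 1. *)
Lemma reducible_core S p e : p \in S -> e \notin S -> adj p e ->
  deg_in (e |: S) p < deg_in (e |: S) e ->
  reducible (fun x => x == p : nat) S -> reducible (fun=> 0) (e |: S).
Proof.
move=> pS eS pe lt_deg redS M uM szM.
have dis : [disjoint [set e] & S] by rewrite disjoints1.
have := szM p; rewrite !inE pS orbT => /(_ isT); rewrite add0n => szp.
have := szM e (setU11 _ _); rewrite add0n => sze.
pose L := take (deg_in (e |: S) p) (M p).
have szL : size L = deg_in (e |: S) p by rewrite size_takel.
have [a aM aL] : exists2 a, a \in M e & forall b, b \in L -> ~~ clash p b e a.
  have := @leq_size_avoid _ _ (fun b a => clash e a p b) L (M e).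
  move=> /(_ (fun b a a' => @clash_inj e p b a a') (uM e)).
  case EM: [seq _ <- _ | _] => [|a l]; first by rewrite /= szL; lia.
  have : a \in [seq a <- M e | ~~ has (fun b => clash e a p b) L].
    by rewrite EM mem_head.
  rewrite mem_filter => /andP[/hasPn no aM] _; exists a => // b /no.
  by rewrite clash_sym.
have [||d dS] := redS (residual M (fun=> a) [set e]).
- by move=> x; apply: residual_uniq.
- move=> x xS; have [->|nxp] := eqVneq x p.
    rewrite /= -(deg_in1 pe) -deg_inU // -szL.
    apply: uniq_leq_size => [|b bL]; first exact: take_uniq.
    rewrite mem_filter (mem_take bL) andbT.
    by apply/forall_inP => y /set1P ->; apply: aL.
  have := szM x; rewrite !inE xS orbT => /(_ isT).
  have := leq_size_residual (fun=> a) [set e] (uM x).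
  rewrite deg_inU //=; lia.
by eexists; apply: coloringU dS; apply: coloring1.
Qed.

(** A largest reducible set is everything as soon as each obstruction [U] to
    enlarging it vertex by vertex, that is each nonempty union of components
    with all degrees at least [k], contains a nonempty degree-choosable set. *)
Lemma colorable_of_reducible k M :
  (forall x, uniq (M x)) -> (forall x, size (M x) = k) ->
  (forall x : H, deg_in setT x <= k) ->
  (forall U : {set H}, U != set0 -> {in U, forall x, k <= deg_in setT x} ->
     (forall x y, x \in U -> adj x y -> y \in U) ->
     exists S, [/\ S != set0, S \subset U & reducible (fun=> 0) S]) ->
  exists c, coloring M setT c.
Proof.
move=> uM szM degk core; pose t x := k - deg_in [set: H] x.
suff redT : reducible t setT.
  by apply: redT => // x _; rewrite szM /t subnK.
pose P (S : {set H}) := `[< reducible t S >].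
have P0 : P set0 by apply/asboolP; apply: reducible0.
case: (@arg_maxnP _ set0 P (fun S => #|S|) P0) => T /asboolP redT maxT.
have nosup S : reducible t S -> T \subset S -> S = T.
  move=> redS sTS; apply/esym/eqP; rewrite eqEcard sTS.
  by apply: maxT; apply/asboolP.
have [U0|Un0] := eqVneq (~: T) set0; first by rewrite -setC0 -U0 setCK.
have attach x : 0 < t x \/ (exists2 y, y \in T & adj x y) -> x \in T.
  by move=> hx; rewrite -(nosup _ (reducible_attach hx redT)) ?setU11 ?subsetUr.
have [||S [Sn0 sSU redS]] := core (~: T) Un0.
- move=> x; rewrite inE leqNgt; apply: contraNN => lt_deg.
  by apply: attach; left; rewrite subn_gt0.
- move=> x y; rewrite !inE => xT xy; apply: contraNN xT => yT.
  by apply: attach; right; exists y.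
have dST : [disjoint S & T] by rewrite disjoints_subset.
case/set0Pn: Sn0 => x xS; have := subsetP sSU x xS; rewrite inE.
suff <- : S :|: T = T by rewrite inE xS.
apply: nosup; last exact: subsetUr.
apply: reducibleU => // N uN szN; apply: redS => // y yS.
by have := szN y yS; rewrite deg_inU //; lia.
Qed.

End Correspondence.

(** * A cycle with one more edge, in minimum degree 3 *)

(** All neighbors of the first vertex [v] of a longest path lie on the path.
    Cutting it at the second neighbor of [v] in path order and closing up gives
    a cycle; a third neighbor of [v] lies further along, hence off the cycle. *)
Lemma cycle_with_extra_edge (G : sgraph) (W : pred G) :
  (exists v, W v) -> (forall v w, W v -> adj v w -> W w) ->
  (forall v, W v -> 2 < #|[pred w | adj v w]|) ->
  exists (v : G) (c : seq G) (b : G), W v /\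
    [/\ cycle (@adj G) (v :: c), uniq (v :: c), 1 < size c, adj v b & b \notin v :: c].
Proof.
move=> [v0 Wv0] Wadj Wdeg.
pose P n := `[< exists v : G, exists s, [/\ W v, path (@adj G) v s, uniq (v :: s) & size s = n] >].
have exP : exists n, P n by exists 0; apply/asboolP; exists v0, [::].
have bndP n : P n -> n <= #|G|.
  case/asboolP => v [s [_ _ us <-]]; apply: ltnW.
  by rewrite -[_.+1]/(size (v :: s)) -(card_uniqP us) max_card.
case: (ex_maxnP exP bndP) => n /asboolP[v [s [Wv vs us szs]]] maxn.
have nbr_s w : adj v w -> w \in s.
  move=> vw; apply: contraT => ws; have := maxn n.+1; rewrite ltnn; apply.
  apply/asboolP; exists w, (v :: s); split; rewrite /= ?szs //.
  - exact: Wadj vw.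
  - by rewrite adj_sym vw.
  move: us => /= ->; rewrite inE negb_or ws !andbT.
  by apply: contraTneq vw => ->; rewrite adj_irrefl.
(* A list of two vertices misses a neighbor of [v]; this is applied to the
   empty path, to the second vertex, and to the first two neighbors. *)
have few (l : seq G) : size l <= 2 -> exists2 w, adj v w & w \notin l.
  move=> szl; have [/exists_inP[w vw wl]|/exists_inPn no] := boolP [exists w in adj v, w \notin l].
    by exists w.
  have := Wdeg v Wv; rewrite ltnNge => /negP[].
  apply: leq_trans szl; apply: leq_trans (card_size l).
  by apply/subset_leq_card/subsetP => w vw; apply/negPn/no.
case: s vs us {maxn szs} nbr_s => [|x s] vs us nbr_s.
  by have [//|w /nbr_s] := few [::].
have : has (adj v) s.
  have [//|w vw wx] := few [:: x]; apply/hasP; exists w => //.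
  by have := nbr_s w vw; move: wx; rewrite !inE => /negPf ->.
move=> has_s; case: (split_find has_s) vs us nbr_s => a r s' va no_r vs us nbr_s.
have [//|b vb bxa] := few [:: x; a].
exists v, (x :: rcons r a), b; split=> //; split=> //.
- move: vs; rewrite /= rcons_path last_rcons cat_path (adj_sym a) va andbT.
  by case/and3P=> -> ->.
- by move: us; rewrite -!cat_cons cat_uniq => /andP[].
- by rewrite /= size_rcons.
rewrite !(inE, mem_rcons) !negb_or; move: bxa; rewrite !inE negb_or.
case/andP=> -> ->; rewrite andTb /=; apply/andP; split.
  by apply: contraTneq vb => ->; rewrite adj_irrefl.
by apply: contra no_r => br; apply/hasP; exists b.
Qed.

(** * Adjacency and degrees in the line graph *)

Section EdgesOf.
Variables (G : sgraph) (e0 : edge G).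
Local Notation LG := (line_graph G).

(** The default edge [e0] makes the construction total; it is only meaningful
    on adjacent vertices. *)
Definition mkedge (x y : G) : LG := insubd e0 [set x; y].

Lemma val_mkedge x y : adj x y -> val (mkedge x y) = [set x; y].
Proof.
move=> xy; rewrite insubdK //.
by apply/imsetP; exists (x, y); rewrite ?inE.
Qed.

Lemma edge_at (e : LG) x : x \in val e -> exists2 y, adj x y & e = mkedge x y.
Proof.
have [[u v] /= [uv ve]] := edge_pair e; rewrite ve !inE => /orP[] /eqP ->.
  by exists v => //; apply: val_inj; rewrite val_mkedge.
by exists u; rewrite 1?adj_sym //; apply: val_inj; rewrite val_mkedge 1?adj_sym // setUC.
Qed.

Lemma edge_end (e : LG) : exists x, x \in val e.
Proof. by have [[u v] /= [_ ->]] := edge_pair e; exists u; rewrite !inE eqxx. Qed.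

Lemma line_adjP (e f : LG) :
  reflect (e != f /\ exists2 x, x \in val e & x \in val f) (adj e f).
Proof.
apply: (iffP andP) => -[nef]; rewrite -setI_eq0.
  by case/set0Pn => x; rewrite inE => /andP[xe xf]; split=> //; exists x.
by case=> x xe xf; split=> //; apply/set0Pn; exists x; rewrite inE xe.
Qed.

Lemma mkedge_inj x y z : adj x y -> adj x z -> mkedge x y = mkedge x z -> y = z.
Proof.
move=> xy xz /(congr1 val); rewrite !val_mkedge // => /setP /(_ y).
rewrite !inE eqxx orbT => /esym /orP[] /eqP // yx.
by move: xy; rewrite yx adj_irrefl.
Qed.

(** Each neighbor of an edge is another edge at one of its two ends. *)
Lemma line_degree x y : adj x y -> deg_in setT (mkedge x y) <=
  (#|[pred z | adj x z]| - 1) + (#|[pred z | adj y z]| - 1).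
Proof.
move=> xy.
have at_end (u v : G) : adj u v -> #|[set z | adj u z] :\ v| = #|[pred z | adj u z]| - 1.
  move=> uv; have := cardsD1 v [set z | adj u z]; rewrite inE uv cardsE => ->.
  by rewrite addKn.
rewrite -(at_end x y xy) -(at_end y x); last by rewrite adj_sym.
apply: leq_trans (leq_add (leq_imset_card (mkedge x) _) (leq_imset_card (mkedge y) _)).
apply: leq_trans (leq_card_setU _ _); apply/subset_leq_card/subsetP => f.
rewrite !inE /= => /line_adjP[nef [u]]; rewrite val_mkedge // !inE.
case/orP=> /eqP -> /edge_at [v uv ef]; apply/orP; [left|right]; apply/imsetP;
  exists v => //; rewrite !inE uv andbT; apply: contraNneq nef => vE;
  rewrite ef vE //.
by apply/eqP/val_inj; rewrite !val_mkedge // 1?adj_sym // setUC.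
Qed.

Fixpoint path_edges (x : G) (l : seq G) : {set LG} :=
  if l is y :: l' then mkedge x y |: path_edges y l' else set0.

Lemma path_edges_ends x l f z :
  path (@adj G) x l -> f \in path_edges x l -> z \in val f -> z \in x :: l.
Proof.
elim: l x => [|y l IHl] x /=; first by rewrite inE.
case/andP=> xy yl; rewrite !inE => /predU1P[->|fl zf].
  by rewrite val_mkedge // !inE orbA => ->.
by have := IHl y yl fl zf; rewrite inE => ->; rewrite orbT.
Qed.

(** * The reducible configuration *)

Section Reduction.
Variables (A : eqType) (a0 : A) (clash : LG -> A -> LG -> A -> bool).
Hypothesis clash_sym : forall x a y b, clash x a y b = clash y b x a.
Hypothesis clash_adj : forall x a y b, clash x a y b -> adj x y.
Hypothesis clash_inj :
  forall x y b a a', clash x a y b -> clash x a' y b -> a = a'.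

Lemma reducible_attach_edge t (S : {set LG}) (e f : LG) x :
  f \in S -> x \in val f -> x \in val e ->
  reducible clash t S -> reducible clash t (e |: S).
Proof.
move=> fS xf xe redS; have [<-|nef] := eqVneq f e; first by rewrite (setUidPr _) ?sub1set.
apply: reducible_attach => //; right; exists f => //.
by apply/line_adjP; split; [rewrite eq_sym | exists x].
Qed.

(** A path ending at an edge of [S] is added edge by edge, from its end back to
    its start [x]; the edge through [x] is where the next one is attached. *)
Lemma reducible_attach_path t (S : {set LG}) (f : LG) x l :
  path (@adj G) x l -> f \in S -> last x l \in val f ->
  reducible clash t S ->
  reducible clash t (path_edges x l :|: S) /\
  exists2 e, e \in path_edges x l :|: S & x \in val e.
Proof.
move=> + fS + redS; elim: l x => [|y l IHl] x /=.
  by move=> _ xf; rewrite set0U; split=> //; exists f.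
case/andP=> xy yl lf; have [redl [e eS ye]] := IHl y yl lf.
rewrite -setUA; split; last first.
  by exists (mkedge x y); rewrite ?setU11 // val_mkedge // !inE eqxx.
apply: reducible_attach_edge eS ye _ redl.
by rewrite val_mkedge // !inE eqxx orbT.
Qed.

(** The cycle is [v, x, y, ..., a], and [e = vx], [q = va], [p = vb]. The
    neighbors of [p] are only [e] and [q], as no other cycle edge meets
    [v] or [b], while [e] also has the neighbor [h = xy]. The set without [e] is
    built from [p] by attaching [q] and then the path from [a] back to [x]. *)
Lemma reducible_cycle v c b : cycle (@adj G) (v :: c) -> uniq (v :: c) ->
  1 < size c -> adj v b -> b \notin v :: c ->
  exists S : {set LG}, [/\ S != set0, reducible clash (fun=> 0) S &
    forall e, e \in S -> exists2 z, z \in v :: c & z \in val e].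
Proof.
case: c => [//|x c]; elim/last_ind: c => [//|r a _].
set c := rcons r a => cyc unc _ vb bc.
move: (cyc); rewrite /= rcons_path last_rcons => /and3P[vx xc av].
have va : adj v a by rewrite adj_sym.
pose p := mkedge v b; pose q := mkedge v a; pose e := mkedge v x.
pose S := path_edges x c :|: (q |: [set p]).
have vp : v \in val p by rewrite val_mkedge // !inE eqxx.
have vq : v \in val q by rewrite val_mkedge // !inE eqxx.
have ve : v \in val e by rewrite val_mkedge // !inE eqxx.
have pathS f : f \in path_edges x c -> (v \notin val f) && (b \notin val f).
  move=> fc; apply/andP; split.
    by apply/negP => /(path_edges_ends xc fc); apply/negP; case/andP: unc.
  apply/negP => /(path_edges_ends xc fc).
  by apply/negP; move: bc; rewrite inE negb_or => /andP[].
have npq : p != q.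
  apply: contraNneq bc => /mkedge_inj -> //.
  by rewrite !inE mem_rcons mem_head !orbT.
have npe : p != e.
  by apply: contraNneq bc => /mkedge_inj -> //; rewrite !inE eqxx !orbT.
have nqe : q != e.
  apply: contraTneq unc => /(mkedge_inj va vx) ax.
  by rewrite /c ax /= mem_rcons mem_head /= andbF.
have peS : adj p e by apply/line_adjP; split=> //; exists v.
have eS : e \notin S.
  rewrite !inE !negb_or [e == p]eq_sym [e == q]eq_sym npe nqe !andbT.
  by apply/negP => /pathS; rewrite ve.
have pS : p \in S by rewrite !inE eqxx !orbT.
have [y [l Ec]] : exists y l, c = y :: l.
  by rewrite /c; case: (r) => [|y l] /=; do 2!eexists.
pose h := mkedge x y.
have xy : adj x y by move: xc; rewrite Ec /= => /andP[].
have hc : h \in path_edges x c by rewrite Ec /= setU11.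
have xh : x \in val h by rewrite val_mkedge // !inE eqxx.
have nvh : v \notin val h by case/andP: (pathS h hc).
have neh : e != h by apply: contraTneq nvh => <-; rewrite negbK.
exists (e |: S); split.
- by apply/set0Pn; exists e; rewrite setU11.
- apply: (@reducible_core _ _ _ clash_sym clash_adj clash_inj _ p) => //.
    apply: (@leq_ltn_trans 2).
      apply: (@leq_trans #|[set e; q]|); last by rewrite cards2; case: (_ != _).
      apply/subset_leq_card/subsetP => f; rewrite !inE => /andP[fS].
      move=> /line_adjP[npf [z zp zf]]; move: fS.
      rewrite (negPf (_ : f != p)) 1?eq_sym // orbF => /or3P[-> //| |->]; rewrite ?orbT //.
      move: zp; rewrite val_mkedge // !inE => /orP[] /eqP zE /pathS;
        by rewrite -zE zf ?andbF.
    apply: (@leq_trans #|[set h; q; p]|).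
      rewrite -setUA cardsU1 cards2 eq_sym npq !inE negb_or.
      by rewrite !(contraNneq _ nvh) // => ->.
    apply/subset_leq_card/subsetP => f; rewrite !inE.
    rewrite -orbA => /or3P[] /eqP ->; rewrite ?hc ?eqxx ?orbT /=; apply/line_adjP.
    + by split=> //; exists x; rewrite // val_mkedge // !inE eqxx orbT.
    + by rewrite eq_sym; split=> //; exists v.
    + by rewrite eq_sym; split=> //; exists v.
  have red1 : reducible clash (fun f => f == p : nat) [set p].
    rewrite -[[set p]]setU0; apply: reducible_attach => //.
      by left; rewrite eqxx.
    exact: reducible0.
  have redq := reducible_attach_edge (set11 p) vp vq red1.
  have [] // := reducible_attach_path xc (setU11 q _) _ redq.
  by rewrite last_rcons val_mkedge // !inE eqxx orbT.
- move=> f; rewrite !inE => /or4P[/eqP ->|fc|/eqP ->|/eqP ->];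
    try by exists v; rewrite // mem_head.
  have [z zf] := edge_end f; exists z => //.
  by have := path_edges_ends xc fc zf; rewrite [in X in _ -> X]inE => ->; rewrite orbT.
Qed.

(** The hypotheses on [k] do two things: no edge has more than [k] neighbors,
    and an edge [xy] with at least [k] of them satisfies
    [deg x >= k + 2 - deg y >= 3]. *)
Lemma line_graph_coloring k (M : LG -> seq A) :
  max_degree G + 1 <= k -> 2 * max_degree G - 2 <= k ->
  (forall e, uniq (M e)) -> (forall e, size (M e) = k) ->
  exists c, coloring clash M setT c.
Proof.
move=> k1 k2 uM szM.
have degG (x : G) : #|[pred z | adj x z]| <= max_degree G.
  exact: (@leq_bigmax_cond G xpredT (fun x : G => #|[pred z | adj x z]|) x isT).
apply: (colorable_of_reducible a0 clash_sym clash_adj clash_inj uM szM).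
  move=> e; have [x /edge_at[y xy ->]] := edge_end e.
  apply: leq_trans (line_degree xy) _; have := degG x; have := degG y; lia.
move=> U Un0 Udeg Uadj; pose W x := [exists e in U, x \in val e].
have WU (e : LG) x : W x -> x \in val e -> e \in U.
  case/exists_inP => f fU xf xe; have [<-//|nfe] := eqVneq f e.
  by apply: (Uadj f) => //; apply/line_adjP; split=> //; exists x.
have Wadj (v w : G) : W v -> adj v w -> W w.
  move=> Wv vw; apply/exists_inP; exists (mkedge v w).
    by apply: (WU _ v) => //; rewrite val_mkedge // !inE eqxx.
  by rewrite val_mkedge // !inE eqxx orbT.
have [|||v [c [b [Wv [cyc unc szc vb bc]]]]] := @cycle_with_extra_edge G W.
- have [e eU] := set0Pn _ Un0; have [x xe] := edge_end e.
  by exists x; apply/exists_inP; exists e.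
- exact: Wadj.
- move=> x /exists_inP[e /Udeg] + /edge_at[y xy eE]; rewrite eE => ke.
  have := leq_trans ke (line_degree xy); have := degG x; have := degG y; lia.
have [S [Sn0 redS Sc]] := reducible_cycle cyc unc szc vb bc.
exists S; split=> //; apply/subsetP => e /Sc[z zc ze].
have Wpath x l : W x -> path (@adj G) x l -> {in x :: l, forall y, W y}.
  elim: l x => [|y l IHl] x Wx /=; first by move=> _ y; rewrite inE => /eqP ->.
  case/andP=> xy yl w; rewrite inE => /predU1P[-> //|].
  exact: IHl (Wadj _ _ Wx xy) yl w.
apply: WU ze; apply: (Wpath v (rcons c v)) => //.
by rewrite -rcons_cons mem_rcons inE zc orbT.
Qed.

End Reduction.
End EdgesOf.

(** * From correspondence coloring to group coloring *)

(** An edge of the line graph joining [x] and [y] is unique, and so is its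
    direction; hence the color [b] of [y] forbids [x] a single color,
    [b + f e] or [b - f e] according to that direction. *)
Lemma edge_group_choosable_of_max_degree (G : sgraph) k :
  max_degree G + 1 <= k -> 2 * max_degree G - 2 <= k ->
  edge_group_choosable G k.
Proof.
move=> k1 k2 o A L _ cardL f; pose LG := line_graph G.
pose joins (e : edge LG) (x y : LG) := (tail o e == x) && (Defs.head o e == y).
pose clash (x : LG) (a : A) (y : LG) (b : A) := [exists e : edge LG,
  joins e x y && (a - b == f e)%R || joins e y x && (b - a == f e)%R].
have clashP x a y b : clash x a y b -> exists e : edge LG,
    joins e x y /\ (a - b = f e)%R \/ joins e y x /\ (b - a = f e)%R.
  by case/existsP => e /orP[] /andP[j /eqP fe]; exists e; [left|right].
have clash_sym x a y b : clash x a y b = clash y b x a.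
  by apply: eq_existsb => e; rewrite orbC.
have clash_adj x a y b : clash x a y b -> adj x y.
  case/clashP => e [] [/andP[/eqP <- /eqP <-] _]; first exact: adj_tail_head.
  by rewrite adj_sym; apply: adj_tail_head.
have clash_inj x y b a a' : clash x a y b -> clash x a' y b -> a = a'.
  move=> cl; have nxy : x <> y.
    by move=> xy; move: (clash_adj _ _ _ _ cl); rewrite xy adj_irrefl.
  case/clashP: cl => e je /clashP[e' je'].
  case: je je' => -[/andP[/eqP t /eqP h] fe] [] [/andP[/eqP t' /eqP h'] fe'].
  - have ee : e = e' by apply: (edge_inj (o := o)); left; rewrite t h.
    by apply: (GRing.addIr (- b)%R); rewrite fe ee.
  - have ee : e = e' by apply: (edge_inj (o := o)); right; rewrite t h.
    by case: nxy; rewrite -t -t' ee.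
  - have ee : e = e' by apply: (edge_inj (o := o)); right; rewrite t h.
    by case: nxy; rewrite -h -h' ee.
  - have ee : e = e' by apply: (edge_inj (o := o)); left; rewrite t h.
    by apply/GRing.oppr_inj/(GRing.addrI b); rewrite fe ee.
have [e0 _|noedge] := pickP (edge G); last first.
  by exists (fun=> 0%R); split=> [v|e]; [have := noedge v | have := noedge (tail o e)].
pose M (e : LG) : seq A := fset_set (L e).
have finL e : finite_set (L e) by apply/finite_setP; exists k; apply: cardL.
have [||c [cM cok]] := line_graph_coloring e0 0%R clash_sym clash_adj clash_inj (M := M) k1 k2.
- by move=> e; apply: fset_uniq.
- by move=> e; apply: card_fset_set.
exists c; split=> [v|e fe].
  by have := cM v (in_setT v); rewrite in_fset_set // classical_sets.inE.
have /negP[] := cok (tail o e) (Defs.head o e) (in_setT _) (in_setT _).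
by apply/existsP; exists e; rewrite /joins !eqxx fe eqxx.
Qed.

Lemma chi_gl'_le (G : sgraph) k : edge_group_choosable G k -> chi_gl' G <= k.
Proof.
by move=> ch; rewrite /chi_gl' /chi_gl; case: ex_minnP => m _; apply; apply/asboolP.
Qed.

Theorem theorem2p5 (G : sgraph) :
  (max_degree G <= 3 -> chi_gl' G <= max_degree G + 1) /\
  (max_degree G = 4 -> chi_gl' G <= 6).
Proof.
split=> degG; apply: chi_gl'_le; apply: edge_group_choosable_of_max_degree; lia.
Qed.
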